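(* Let $\mathbb{U}=\mathbb{U}(\ell_2)$ be the group of all unitary operators on the separable, infinite-dimensional, complex Hilbert space $\ell_2$, regarded as a discrete (abstract) group. Then $\mathbb{U}$ is Cayley bounded and has uncountable cofinality.
   Context: An uncountable group $G$ has uncountable cofinality if $G$ is not the union of a countable increasing chain $G_0\subseteq G_1\subseteq G_2\subseteq\cdots$ of proper subgroups of $G$. A group $G$ is Cayley bounded if, whenever $E\subseteq G$ is a symmetric ($E=E^{-1}$) generating set for $G$ containing the identity, there is some finite $n$ such that $G=E^n$, where $E^n=\{g_1g_2\cdots g_n : g_1,\ldots,g_n\in E\}$, i.e. every element of $G$ can be written as a word of length $n$ in elements of $E$. No topological assumptions are made on the subgroups or generating sets. *)

(* Defs.v *)
From HB Require Import structures.
From mathcomp Require Import all_boot all_order all_algebra complex.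
From mathcomp Require Import all_classical all_reals all_analysis.
From mathcomp Require Import ring lra.

Set Implicit Arguments.
Unset Strict Implicit.
Unset Printing Implicit Defensive.

Import Order.TTheory GRing.Theory Num.Theory numFieldNormedType.Exports.
Import ComplexField.Normc.

Local Open Scope classical_set_scope.
Local Open Scope ring_scope.
Local Open Scope complex_scope.

Definition is_subgroup (G : groupType) (H : set G) : Prop :=
  [/\ H 1%g, forall x y, H x -> H y -> H (x * y)%g & forall x, H x -> H x^-1%g].

Definition generates (G : groupType) (E : set G) : Prop :=
  smallest (@is_subgroup G) E = setT.

Definition word_power (G : groupType) (E : set G) (n : nat) : set G :=
  [set g | exists2 w : 'I_n -> G,
    forall i, E (w i) & g = (\prod_(i < n) w i)%g].

Definition cayley_bounded (G : groupType) : Prop :=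
  forall E : set G,
    [set x^-1%g | x in E] = E -> E 1%g -> generates E ->
    exists n : nat, word_power E n = setT.

Definition uncountable_cofinality (G : groupType) : Prop :=
  ~ countable [set: G] /\
  ~ exists H : nat -> set G,
      [/\ forall n, is_subgroup (H n),
          forall n, H n <> setT,
          forall n, H n `<=` H n.+1 &
          \bigcup_n H n = setT].

(* [normc] is the modulus of a complex number, with values in [R]. *)
Definition square_summable (R : realType) (x : nat -> R[i]) : Prop :=
  cvgn (series (fun k => normc (x k) ^+ 2 : R)).

Definition ell2_pred (R : realType) : {pred nat -> R[i]} :=
  mem [set x : nat -> R[i] | square_summable x].

Lemma ell2_submod_closed (R : realType) : submod_closed (@ell2_pred R).
Proof.
split.
  apply/mem_set; rewrite /= /square_summable.
  have -> : series (fun k => normc ((0 : nat -> R[i]) k) ^+ 2) = cst 0.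
    apply/funext => n; rewrite /series /= big1 // => k _.
    by rewrite expr0n /= addr0 sqrtr0 expr0n.
  exact: is_cvg_cst.
move=> a x y /set_mem xl /set_mem yl; apply/mem_set; move: xl yl.
rewrite /= /square_summable => xl yl.
pose u k : R := 2 * (normc a ^+ 2 * normc (x k) ^+ 2 + normc (y k) ^+ 2).
have u_cvg : cvgn (series u).
  have -> : series u = (fun n => 2 * (normc a ^+ 2 * series (fun k => normc (x k) ^+ 2) n
                            + series (fun k => normc (y k) ^+ 2) n)).
    by apply/funext => n; rewrite /series mulr_sumr -big_split mulr_sumr.
  by apply: is_cvgMr; apply: is_cvgD => //; exact: is_cvgMr.
apply: series_le_cvg u_cvg => k; first exact: sqr_ge0.
  by apply: mulr_ge0 => //; apply: addr_ge0; [apply: mulr_ge0|]; exact: sqr_ge0.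
rewrite /u -exprMn -normcM; set b := a * x k.
have -> : (a *: x + y) k = b + y k by [].
have h := le_normcD b (y k).
have h0 : 0 <= normc (b + y k) by case: (b + y k) => p q; exact: sqrtr_ge0.
have := sqr_ge0 (normc b - normc (y k)).
nra.
Qed.

HB.instance Definition _ (R : realType) :=
  GRing.isSubmodClosed.Build R[i] (nat -> R[i]) (@ell2_pred R)
    (@ell2_submod_closed R).

Record ell2 (R : realType) : Type :=
  Ell2 { ell2_seq :> nat -> R[i]; _ : ell2_seq \in @ell2_pred R }.

HB.instance Definition _ (R : realType) := [isSub for @ell2_seq R].
HB.instance Definition _ (R : realType) := [Choice of ell2 R by <:].
HB.instance Definition _ (R : realType) :=
  [SubChoice_isSubLmodule of ell2 R by <:].

(* [R[i]^o] carries the topology of the complex modulus; the series always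
   converges, see [is_cvg_dot_ell2]. *)
Definition dot_ell2 (R : realType) (x y : ell2 R) : R[i] :=
  limn (series (fun k => x k * (y k)^*) : (R[i]^o)^nat).

Lemma cvg_complex (R : realType) (z : nat -> R[i]) :
  cvgn (fun n => complex.Re (z n)) -> cvgn (fun n => complex.Im (z n)) ->
  cvgn (z : (R[i]^o)^nat).
Proof.
move=> /cvg_ex[/= a za] /cvg_ex[/= b zb].
apply/cvg_ex; exists (a +i* b : R[i]^o).
apply/cvgrPdist_lt => e; case: e => e e'; rewrite ltcE /= => /andP[/eqP -> e0].
have e20 : 0 < e / 2 by rewrite divr_gt0.
move/cvgrPdist_lt : za => /(_ _ e20) za; move/cvgrPdist_lt : zb => /(_ _ e20) zb.
near=> n.
have : `|a - complex.Re (z n)| < e / 2 by near: n.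
have : `|b - complex.Im (z n)| < e / 2 by near: n.
case: (z n) => p q /= hb ha.
rewrite normc_def ltcE /= eqxx /=.
rewrite -[ltRHS]gtr0_norm // -sqrtr_sqr ltr_sqrt ?exprn_gt0 //.
rewrite -[X in X + _]real_normK ?num_real // -[X in _ + X]real_normK ?num_real //.
have := normr_ge0 (a - p); have := normr_ge0 (b - q).
have -> : b - q = b + - q by [].
nra.
Unshelve. all: by end_near. Qed.

Lemma is_cvg_dot_ell2 (R : realType) (x y : ell2 R) :
  cvgn (series (fun k => x k * (y k)^*) : (R[i]^o)^nat).
Proof.
have xl : square_summable x by case: x => x /= /set_mem.
have yl : square_summable y by case: y => y /= /set_mem.
pose u k : R := normc (x k) ^+ 2 + normc (y k) ^+ 2.
have u_cvg : cvgn (series u).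
  have -> : series u = (fun n => series (fun k => normc (x k) ^+ 2) n
                               + series (fun k => normc (y k) ^+ 2) n).
    by apply/funext => n; rewrite /series -big_split.
  exact: is_cvgD.
have dom (v : nat -> R) : (forall k, `|v k| <= u k) -> cvgn (series v).
  move=> vu; apply: normed_cvg; apply: series_le_cvg u_cvg => k //=.
  exact: le_trans (vu k).
have normE (w : R[i]) : normc w ^+ 2 = complex.Re w ^+ 2 + complex.Im w ^+ 2.
  by case: w => a b; rewrite /normc sqr_sqrtr // addr_ge0 // sqr_ge0.
have reE (v : nat -> R[i]) : (fun n => complex.Re (series v n)) = series (fun k => complex.Re (v k)).
  apply/funext => n; rewrite /series /=.
  by apply: (big_ind2 (fun z w => _ z = w)) => // -[? ?] ? [? ?] ? /= -> ->.
have imE (v : nat -> R[i]) : (fun n => complex.Im (series v n)) = series (fun k => complex.Im (v k)).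
  apply/funext => n; rewrite /series /=.
  by apply: (big_ind2 (fun z w => _ z = w)) => // -[? ?] ? [? ?] ? /= -> ->.
apply: cvg_complex; rewrite ?reE ?imE; apply: dom => k; rewrite /u !normE.
  case: (x k) => a b; case: (y k) => c d /=.
  have := sqr_ge0 (a - c); have := sqr_ge0 (a + c).
  have := sqr_ge0 (b - d); have := sqr_ge0 (b + d).
  by rewrite ler_norml => *; apply/andP; split; nra.
case: (x k) => a b; case: (y k) => c d /=.
have := sqr_ge0 (a - d); have := sqr_ge0 (a + d).
have := sqr_ge0 (b - c); have := sqr_ge0 (b + c).
by rewrite ler_norml => *; apply/andP; split; nra.
Qed.

Definition unitary_operator (R : realType) (f : ell2 R -> ell2 R) : Prop :=
  [/\ linear f, bijective f & forall x y, dot_ell2 (f x) (f y) = dot_ell2 x y].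

(* The abstract group of unitary operators, with composition as product: no
   topology is put on it. *)
Record unitary (R : realType) : Type := Unitary {
  unitary_fun :> ell2 R -> ell2 R;
  unitaryP : unitary_operator unitary_fun }.

Lemma unitary_ext (R : realType) (f g : unitary R) : f =1 g -> f = g.
Proof.
case: f g => [f fP] [g gP] /= /funext fg.
by subst g; congr Unitary; exact: Prop_irrelevance.
Qed.

HB.instance Definition _ (R : realType) := gen_eqMixin (unitary R).
HB.instance Definition _ (R : realType) := gen_choiceMixin (unitary R).

Lemma unitary_operator_id (R : realType) : unitary_operator (@id (ell2 R)).
Proof. by split=> //; exists id. Qed.

Lemma unitary_operator_comp (R : realType) (f g : ell2 R -> ell2 R) :
  unitary_operator f -> unitary_operator g -> unitary_operator (f \o g).
Proof.
move=> [fl fb fd] [gl gb gd]; split; last by move=> x y /=; rewrite fd gd.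
- by move=> a x y /=; rewrite gl fl.
- exact: bij_comp.
Qed.

Lemma unitary_inv_subproof (R : realType) (f : unitary R) :
  {g : ell2 R -> ell2 R | cancel f g /\ cancel g f}.
Proof.
apply: cid; case: (unitaryP f) => _ [g fK gK] _.
by exists g.
Qed.

Definition unitary_inv_fun (R : realType) (f : unitary R) : ell2 R -> ell2 R :=
  sval (unitary_inv_subproof f).

Lemma unitary_funK (R : realType) (f : unitary R) : cancel f (unitary_inv_fun f).
Proof. by rewrite /unitary_inv_fun; case: (unitary_inv_subproof f) => g []. Qed.

Lemma unitary_inv_funK (R : realType) (f : unitary R) :
  cancel (unitary_inv_fun f) f.
Proof. by rewrite /unitary_inv_fun; case: (unitary_inv_subproof f) => g []. Qed.

Lemma unitary_operator_inv (R : realType) (f : unitary R) :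
  unitary_operator (unitary_inv_fun f).
Proof.
have [fl fb fd] := unitaryP f.
split.
- move=> a x y; apply: (can_inj (unitary_funK f)).
  by rewrite fl !unitary_inv_funK.
- by exists f; [exact: unitary_inv_funK|exact: unitary_funK].
- by move=> x y; rewrite -fd !unitary_inv_funK.
Qed.

Definition unitary_one (R : realType) : unitary R := Unitary (@unitary_operator_id R).

Definition unitary_mul (R : realType) (f g : unitary R) : unitary R :=
  Unitary (unitary_operator_comp (unitaryP f) (unitaryP g)).

Definition unitary_inv (R : realType) (f : unitary R) : unitary R :=
  Unitary (unitary_operator_inv f).

Lemma unitary_mulA (R : realType) : associative (@unitary_mul R).
Proof. by move=> f g h; exact: unitary_ext. Qed.

Lemma unitary_mul1 (R : realType) :
  left_id (@unitary_one R) (@unitary_mul R).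
Proof. by move=> f; exact: unitary_ext. Qed.

Lemma unitary_mulr1 (R : realType) :
  right_id (@unitary_one R) (@unitary_mul R).
Proof. by move=> f; exact: unitary_ext. Qed.

Lemma unitary_mulV (R : realType) :
  left_inverse (@unitary_one R) (@unitary_inv R) (@unitary_mul R).
Proof. by move=> f; apply: unitary_ext => x; exact: unitary_funK. Qed.

Lemma unitary_mulrV (R : realType) :
  right_inverse (@unitary_one R) (@unitary_inv R) (@unitary_mul R).
Proof. by move=> f; apply: unitary_ext => x; exact: unitary_inv_funK. Qed.

HB.instance Definition _ (R : realType) := isGroup.Build (unitary R)
  (@unitary_mulA R) (@unitary_mul1 R) (@unitary_mulr1 R)
  (@unitary_mulV R) (@unitary_mulrV R).

(* Main.v *)
Require Import Defs.
From mathcomp Require Import all_boot all_order all_algebra.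
From mathcomp Require Import all_classical all_reals all_analysis.
From mathcomp Require Import complex ring.

(** Both properties follow from one statement: if W_0 <= W_1 <= ... are subsets
of the unitary group, closed under inverses, with union the whole group and
W_n W_n <= W_{n+1}, then some W_n is the whole group.  For Cayley boundedness
take W_n = E^(2^n); a chain of proper subgroups H_n covering the group would be
such a chain without a last term.  Uncountability is a diagonal argument on
operators with diagonal entries 1 and -1.

For a set A of indices let Fix(A) be the group of unitaries fixing the basis
vector e_j for all j in A, that is, the unitary group of l2(~A).  Call A a
moiety if A and ~A are infinite.  The statement has two halves.

(1) Fix(A) lies in some W_n, for every moiety A [chain_bounded_fixes].
Cut the indices into infinitely many infinite pieces.  Some piece X is full for
some W_n: every unitary of l2(X) is the restriction to l2(X) of an element of
W_n that preserves l2(X).  Otherwise choose for each n a unitary of l2(X_n)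
that does not extend to an element of W_n; their direct sum lies in no W_n
[chain_full_piece].  Now a swindle replaces the full piece X by an honest
subgroup.  Let s be a permutation of the indices that shifts X along the
integers and is the identity off X, and let u live on the piece X_0.  With v
the direct sum of the translates of u by the s^i for i >= 0, we have
u (s v s^-1) = v [shift_commutator]; replacing v by an element a of W_n that
agrees with it on l2(X) gives u = a s a^-1 s^-1, because what a does off X
commutes with s.  As s is one fixed element, all such u lie in a single W_m.
Conjugating by a permutation of the basis carries ~X_0 to any other moiety.

(2) The whole group is a product of five groups Fix(A), for fixed moieties A
[unitary_factorization].  Write the indices as the disjoint union of infinite
sets Y, X0, X1, X2 (plus a remainder), and let u be any unitary.  Choose, one
after the other, unit vectors f_k, and h_k in l2(X2), each orthogonal to finitely
many vectors determined by the preceding ones, so that with P the projection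
onto l2(~Y) the families P f_k and P u f_k are orthogonal, and every h_k is
orthogonal to every f_i and u f_i [sparse_sequences].  An element of Fix(Y)
sends P f_k to a multiple of h_k; this moves f_k into l2(Y + X2), which leaves
room to send it to a basis vector indexed by X0 by an element of Fix(X1)
[sparse_to_basis].  Hence there are p and q in Fix(X1) Fix(Y) such that p f_k
and q u f_k are the same basis vectors, and these can be taken to exhaust X0.
So q u p^-1 is in Fix(X0) and u is in Fix(Y) Fix(X1) Fix(X0) Fix(X1) Fix(Y).
No spectral theorem enters: the two orthogonal families are exchanged by the
reflection in the closed span of their differences [reflection].

The operators needed, for an orthonormal family d, are built from the map
S x = (<x, d_k>)_k and its adjoint, which exists by the Riesz representation
theorem [riesz]: S^* carries the standard basis to d, and 1 - 2 S^* S is the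
reflection. *)

Set Implicit Arguments.
Unset Strict Implicit.
Unset Printing Implicit Defensive.

Import Order.TTheory GRing.Theory Num.Theory numFieldNormedType.Exports.
Import ComplexField.Normc.

Local Open Scope classical_set_scope.
Local Open Scope complex_scope.
(* The ring scope comes last so that the postfix star is [Num.conj], which is
   the conjugation in the definition of the inner product. *)
Local Open Scope ring_scope.

Local Notation dot := dot_ell2.

(** * Infinite sets of natural numbers *)

Lemma infinite_of_inj (T : Type) (f : nat -> T) (A : set T) :
  injective f -> (forall k, A (f k)) -> infinite_set A.
Proof.
move=> fI fA; apply/infiniteP.
have /card_eqPle[_ h] : ([set f x | x in setT] #= [set: nat])%card.
  by apply: inj_card_eq => x y _ _; exact: fI.
by apply: card_le_trans h _; apply: subset_card_le => _ [k _ <-].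
Qed.

Lemma infinite_nat_enum (A : set nat) : infinite_set A ->
  exists nu : nat -> nat, [/\ injective nu, forall k, A (nu k) &
    forall j, A j -> exists k, nu k = j].
Proof.
move=> /infiniteP Ainf; have : ([set: nat] #= A)%card.
  by apply/card_eqPle; split => //; exact: countableP.
move=> /card_set_bijP[nu [nuA nuI nuS]]; exists nu; split.
- by move=> i j; apply: nuI; rewrite inE.
- by move=> k; apply: nuA.
- by move=> j /nuS[k _ <-]; exists k.
Qed.

(** Matching enumerations of the fibers of p with enumerations of the fibers of
q.  With labels in bool this moves any infinite set with infinite complement to
any other such set. *)
Lemma bij_of_fibers (T : Type) (p q : nat -> T) :
  (forall t, infinite_set [set j | p j = t]) ->
  (forall t, infinite_set [set j | q j = t]) ->
  exists s : nat -> nat, bijective s /\ forall j, q (s j) = p j.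
Proof.
move=> /(_ _)/infinite_nat_enum-/choice[N NP].
move=> /(_ _)/infinite_nat_enum-/choice[M MP].
have /choice[a aP] : forall j, exists k, N (p j) k = j.
  by move=> j; have [_ _] := NP (p j); apply.
have /choice[b bP] : forall j, exists k, M (q j) k = j.
  by move=> j; have [_ _] := MP (q j); apply.
have qM t k : q (M t k) = t by have [_ h _] := MP t; exact: h.
have pN t k : p (N t k) = t by have [_ h _] := NP t; exact: h.
have MI t : injective (M t) by case: (MP t).
have NI t : injective (N t) by case: (NP t).
exists (fun j => M (p j) (a j)); split; last by move=> j; rewrite qM.
exists (fun j => N (q j) (b j)) => j.
  rewrite qM -[RHS]aP; congr (N _ _).
  by apply: (MI (p j)); have := bP (M (p j) (a j)); rewrite qM.
rewrite pN -[RHS]bP; congr (M _ _).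
by apply: (NI (q j)); have := aP (N (q j) (b j)); rewrite pN.
Qed.

Lemma bij_nat (T : countType) : infinite_set [set: T] ->
  exists f : T -> nat, bijective f.
Proof.
move=> /infiniteP Tinf; have : ([set: T] #= [set: nat])%card.
  by apply/card_eqPle; split => //; exact: countableP.
by case/card_set_bijP => f; rewrite setTT_bijective; exists f.
Qed.

Lemma infinite_partition_nat :
  exists p : nat -> nat, forall n, infinite_set [set j | p j = n].
Proof.
have [psi [phi psiK phiK]] := bij_nat infinite_prod_nat.
exists (fun j => (phi j).1) => n.
apply: (@infinite_of_inj _ (fun k => psi (n, k))) => [k k' /(can_inj psiK)[]//|k /=].
by rewrite psiK.
Qed.

(** * The inner product of l2 *)

Lemma normc_ge0 (R : realType) (z : R[i]) : 0 <= normc z.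
Proof. by case: z => a b; exact: sqrtr_ge0. Qed.

Lemma sqr_normcE (R : realType) (z : R[i]) : (normc z ^+ 2)%:C = z * z^*.
Proof. by rewrite -normCK rmorphXn. Qed.

Lemma cvg_normc (R : realType) (z : nat -> R[i]) (l : R[i]) :
  (fun n => normc (l - z n) ^+ 2) @ \oo --> (0 : R) ->
  (z : (R[i]^o)^nat) @ \oo --> (l : R[i]^o).
Proof.
move=> zl; apply/cvgrPdist_lt => -[e e']; rewrite ltcE /= => /andP[/eqP -> e0].
have e20 : 0 < e ^+ 2 by rewrite exprn_gt0.
move/cvgrPdist_lt : zl => /(_ _ e20); apply: filterS => n.
rewrite sub0r normrN ger0_norm ?sqr_ge0// => h.
have -> : `|l - z n| = (normc (l - z n))%:C by [].
by rewrite ltcR -(@ltr_pXn2r _ 2) // ?nnegrE ?normc_ge0 // ltW.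
Qed.

(* Simplification would otherwise turn coordinates of sums of vectors into
   values of sums of functions. *)
Arguments ell2_seq {R} _ _ : simpl never.

Section Coordinates.
Variable R : realType.
Implicit Types x y : ell2 R.

Lemma ell2D x y k : ell2_seq (x + y) k = x k + y k. Proof. by []. Qed.
Lemma ell2Z (a : R[i]) x k : ell2_seq (a *: x) k = a * x k. Proof. by []. Qed.
Lemma ell2N x k : ell2_seq (- x) k = - x k. Proof. by []. Qed.

Lemma ell2_sum (I : Type) (r : seq I) (P : pred I) (F : I -> ell2 R) k :
  ell2_seq (\sum_(i <- r | P i) F i) k = \sum_(i <- r | P i) F i k.
Proof. by apply: (big_morph (fun x : ell2 R => x k)). Qed.

Lemma ell2P x y : x =1 y -> x = y.
Proof.
case: x y => [x xP] [y yP] xy; have {xy} /funext xy : x =1 y := xy.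
subst y; congr Ell2; exact: bool_irrelevance.
Qed.

End Coordinates.

Lemma square_summable_bounded (R : realType) (y : nat -> R[i]) (M : R) :
  (forall n, \sum_(k < n) normc (y k) ^+ 2 <= M) -> square_summable y.
Proof.
move=> yM; apply: nondecreasing_is_cvgn.
  apply/nondecreasing_seqP => n; rewrite !seriesEnat /= big_nat_recr //=.
  by rewrite lerDl sqr_ge0.
by exists M => _ [n _ <-]; rewrite seriesEord /=; exact: yM.
Qed.

Definition mk_ell2 (R : realType) (y : nat -> R[i]) (h : square_summable y) :
    ell2 R :=
  Ell2 (mem_set h : y \in @ell2_pred R).

Definition normsq (R : realType) (x : ell2 R) : R :=
  limn (series (fun k => normc (x k) ^+ 2)).

Lemma ell2_square_summable (R : realType) (x : ell2 R) : square_summable x.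
Proof. by case: x => x xP; exact: (set_mem xP). Qed.

Lemma cvg_normsq (R : realType) (x : ell2 R) :
  (fun n => \sum_(k < n) normc (x k) ^+ 2) @ \oo --> normsq x.
Proof.
have -> : (fun n => \sum_(k < n) normc (x k) ^+ 2) =
  series (fun k => normc (x k) ^+ 2) by apply/funext => n; rewrite seriesEord.
exact: (@ell2_square_summable R x).
Qed.

Arguments cvg_normsq {R} x.

Lemma cvg_dot (R : realType) (x y : ell2 R) :
  (fun n => \sum_(k < n) x k * (y k)^* : R[i]^o) @ \oo --> (dot_ell2 x y : R[i]^o).
Proof.
have -> : (fun n => \sum_(k < n) x k * (y k)^* : R[i]^o) =
  series (fun k => x k * (y k)^*) by apply/funext => n; rewrite seriesEord.
exact: (@is_cvg_dot_ell2 R x y).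
Qed.

Arguments cvg_dot {R} x y.

Lemma dot_unique (R : realType) (x y : ell2 R) (l : R[i]) :
  (fun n => \sum_(k < n) x k * (y k)^* : R[i]^o) @ \oo --> (l : R[i]^o) ->
  dot_ell2 x y = l.
Proof.
by move=> h; apply: (cvg_unique _ (cvg_dot x y) h); exact: norm_hausdorff.
Qed.

Lemma normsq_ge_partial (R : realType) (x : ell2 R) n :
  \sum_(k < n) normc (x k) ^+ 2 <= normsq x.
Proof.
have -> : \sum_(k < n) normc (x k) ^+ 2 = series (fun k => normc (x k) ^+ 2) n.
  by rewrite seriesEord.
apply: nondecreasing_cvgn_le; last exact: (@ell2_square_summable R x).
apply/nondecreasing_seqP => m; rewrite !seriesEnat /= big_nat_recr //=.
by rewrite lerDl sqr_ge0.
Qed.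

Lemma dotDZl (R : realType) (a : R[i]) (x y z : ell2 R) :
  dot_ell2 (a *: x + y) z = a * dot_ell2 x z + dot_ell2 y z.
Proof.
apply: dot_unique.
have -> : (fun n => \sum_(k < n) ell2_seq (a *: x + y) k * (z k)^* : R[i]^o) =
  (fun n => a *: (\sum_(k < n) x k * (z k)^* : R[i]^o)) \+
  (fun n => (\sum_(k < n) y k * (z k)^* : R[i]^o)).
  apply/funext => n /=; rewrite scaler_sumr -big_split /=.
  by apply: eq_bigr => k _; rewrite ell2D ell2Z mulrDl -mulrA.
by apply: cvgD; [apply: cvgZl_tmp|]; exact: cvg_dot.
Qed.

Lemma dotC (R : realType) (x y : ell2 R) : dot_ell2 y x = (dot_ell2 x y)^*.
Proof.
apply: dot_unique; apply/cvgrPdist_lt => e e0.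
move/cvgrPdist_lt : (cvg_dot x y) => /(_ _ e0); apply: filterS => n.
rewrite -norm_conjC rmorphB /= rmorph_sum /=.
by under eq_bigr do rewrite rmorphM /= conjCK mulrC.
Qed.

Lemma dotE (R : realType) (x : ell2 R) : dot_ell2 x x = (normsq x)%:C.
Proof.
apply: dot_unique; apply: cvg_normc.
have := cvg_normsq x; move/cvgrPdist_lt => h; apply/cvgrPdist_lt => e e0.
(* The modulus of the error occurs squared in the goal, hence the bound by 1. *)
have := h (Num.min e 1); rewrite lt_min e0 ltr01 => /(_ isT); apply: filterS => n.
have -> : \sum_(k < n) x k * (x k)^* = (\sum_(k < n) normc (x k) ^+ 2)%:C.
  by rewrite rmorph_sum; apply: eq_bigr => k _; exact/esym/sqr_normcE.
rewrite -rmorphB /= sub0r normrN /= expr0n /= addr0 sqrtr_sqr.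
set d := `|_ - _|; rewrite lt_min => /andP[de d1].
rewrite ger0_norm ?sqr_ge0//; apply: le_lt_trans de.
by rewrite expr2 ler_piMl ?normr_ge0 // ltW.
Qed.

Section InnerProduct.
Variable R : realType.
Implicit Types (a : R[i]) (x y z : ell2 R).

Lemma dot0l x : dot 0 x = 0.
Proof. by have := dotDZl (-1) 0 0 x; rewrite scaler0 addr0 mulN1r addNr. Qed.

Lemma dotDl x y z : dot (x + y) z = dot x z + dot y z.
Proof. by rewrite -{1}[x]scale1r dotDZl mul1r. Qed.

Lemma dotZl a x z : dot (a *: x) z = a * dot x z.
Proof. by rewrite -[a *: x]addr0 dotDZl dot0l addr0. Qed.

Lemma dotNl x z : dot (- x) z = - dot x z.
Proof. by rewrite -scaleN1r dotZl mulN1r. Qed.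

Lemma dotBl x y z : dot (x - y) z = dot x z - dot y z.
Proof. by rewrite dotDl dotNl. Qed.

Lemma dot0r x : dot x 0 = 0. Proof. by rewrite dotC dot0l conjC0. Qed.

Lemma dotDr x y z : dot z (x + y) = dot z x + dot z y.
Proof. by rewrite dotC dotDl rmorphD /= -!dotC. Qed.

Lemma dotZr a x z : dot z (a *: x) = a^* * dot z x.
Proof. by rewrite dotC dotZl rmorphM /= -dotC. Qed.

Lemma dotNr x z : dot z (- x) = - dot z x.
Proof. by rewrite dotC dotNl rmorphN /= -dotC. Qed.

Lemma dotBr x y z : dot z (x - y) = dot z x - dot z y.
Proof. by rewrite dotDr dotNr. Qed.

Lemma dot_suml (I : Type) (r : seq I) (P : pred I) (F : I -> ell2 R) z :
  dot (\sum_(i <- r | P i) F i) z = \sum_(i <- r | P i) dot (F i) z.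
Proof.
by apply: (big_morph (fun x => dot x z) (fun x y => dotDl x y z) (dot0l z)).
Qed.

Lemma dot_sumr (I : Type) (r : seq I) (P : pred I) (F : I -> ell2 R) z :
  dot z (\sum_(i <- r | P i) F i) = \sum_(i <- r | P i) dot z (F i).
Proof.
by apply: (big_morph (fun x => dot z x) (fun x y => dotDr x y z) (dot0r z)).
Qed.

Lemma dot_eq0C x y : dot x y = 0 -> dot y x = 0.
Proof. by move=> h; rewrite dotC h conjC0. Qed.

Lemma normsq_ge0 x : 0 <= normsq x.
Proof. by have := normsq_ge_partial x 0; rewrite big_ord0. Qed.

Lemma dot_ge0 x : 0 <= dot x x.
Proof. by rewrite dotE ler0c normsq_ge0. Qed.

Lemma dot_eq0 x : dot x x = 0 -> x = 0.
Proof.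
rewrite dotE => -[] x0; apply: ell2P => k; apply: eq0_normc; apply/eqP.
rewrite -sqrf_eq0 eq_le sqr_ge0 andbT -x0.
apply: le_trans (normsq_ge_partial x k.+1); rewrite big_ord_recr /= lerDr.
by apply: sumr_ge0 => i _; exact: sqr_ge0.
Qed.

Definition ell2_norm x : R[i] := (Num.sqrt (normsq x))%:C.

Lemma sqr_ell2_norm x : ell2_norm x * ell2_norm x = dot x x.
Proof. by rewrite -rmorphM -expr2 sqr_sqrtr ?normsq_ge0// dotE. Qed.

Lemma conj_ell2_norm x : (ell2_norm x)^* = ell2_norm x.
Proof. exact: conjc_real. Qed.

Lemma ell2_norm_eq0 x : (ell2_norm x == 0) = (x == 0).
Proof.
apply/eqP/eqP => [x0|->]; first by apply: dot_eq0; rewrite -sqr_ell2_norm x0 mulr0.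
by apply/eqP; rewrite -sqrf_eq0 expr2 sqr_ell2_norm dot0l.
Qed.

(** Since 0^-1 = 0, normalizing is harmless for null vectors. *)
Lemma dot_normalize x :
  dot ((ell2_norm x)^-1 *: x) ((ell2_norm x)^-1 *: x) = (x != 0)%:R.
Proof.
rewrite dotZl dotZr fmorphV /= conj_ell2_norm -sqr_ell2_norm.
have [->|x0] := eqVneq x 0; last by rewrite mulKf ?mulVf ?ell2_norm_eq0.
by rewrite sqr_ell2_norm dot0l !mulr0.
Qed.

Lemma stdvec_square_summable (n : nat) :
  square_summable (fun k : nat => (k == n)%:R : R[i]).
Proof.
apply: (@square_summable_bounded _ _ 1) => m.
apply: (@le_trans _ _ (\sum_(k < m) (k == n :> nat)%:R)).
  apply: ler_sum => k _; case: eqP => _; first by rewrite mulr1n normc1 expr1n.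
  by rewrite mulr0n normc0 expr0n.
rewrite -natr_sum lern1 -big_mkcond /= sum1_card; apply/card_le1_eqP => i j.
by move=> /eqP ij /eqP jn; apply: val_inj; rewrite /= ij jn.
Qed.

Definition stdvec (n : nat) : ell2 R := mk_ell2 (@stdvec_square_summable n).

Lemma stdvecE n k : stdvec n k = (k == n)%:R. Proof. by []. Qed.

Lemma dot_stdvecr x n : dot x (stdvec n) = x n.
Proof.
apply: dot_unique; apply: cvg_near_cst.
near=> m; have nm : (n < m)%N by near: m; exact: nbhs_infty_gt.
rewrite (bigD1 (Ordinal nm)) //= stdvecE eqxx conjC1 mulr1 big1 ?addr0// => k.
by rewrite stdvecE -val_eqE /= => /negbTE ->; rewrite conjC0 mulr0.
Unshelve. all: by end_near. Qed.

Lemma dot_stdvecl x n : dot (stdvec n) x = (x n)^*.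
Proof. by rewrite dotC dot_stdvecr. Qed.

Lemma dot_stdvec i j : dot (stdvec i) (stdvec j) = (i == j)%:R.
Proof. by rewrite dot_stdvecr stdvecE eq_sym. Qed.

Lemma dot_ext x y : (forall z, dot x z = dot y z) -> x = y.
Proof. by move=> h; apply: ell2P => k; rewrite -!dot_stdvecr. Qed.

Lemma cauchy_schwarz x y : normc (dot x y) ^+ 2 <= normsq x * normsq y.
Proof.
have [->|y0] := eqVneq y 0.
  by rewrite dot0r normc0 expr0n /= mulr_ge0 ?normsq_ge0.
have yy0 : dot y y != 0 by apply: contra_neq y0; exact: dot_eq0.
have ry : (dot y y)^* = dot y y by rewrite -dotC.
have y_gt0 : 0 < normsq y.
  by rewrite lt_neqAle normsq_ge0 andbT eq_sym; apply: contra_neq yy0; rewrite dotE => ->.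
have := dot_ge0 (x - (dot x y / dot y y) *: y).
have -> : dot (x - (dot x y / dot y y) *: y) (x - (dot x y / dot y y) *: y) =
  dot x x - dot x y * (dot x y)^* / dot y y.
  rewrite dotBr !dotBl !dotZr !dotZl rmorphM /= fmorphV /= ry (dotC x y).
  by field.
rewrite -sqr_normcE !dotE -rmorphV /=; last by rewrite unitfE gt_eqF.
by rewrite -rmorphM -rmorphB /= ler0c subr_ge0 ler_pdivrMr.
Qed.

End InnerProduct.

Arguments stdvec {R} n.

(** * Riesz representation and the adjoint of a Bessel map *)

Section Riesz.
Variable R : realType.
Local Notation stdvec := (@stdvec R).
Implicit Types (x y z : ell2 R).

(** Null vectors are allowed because normalization keeps them, and reflections
are later taken in families built from projections, which may vanish. *)
Definition subunit (d : nat -> ell2 R) : Prop :=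
  (forall i j, i != j -> dot (d i) (d j) = 0) /\
  forall i, dot (d i) (d i) = (d i != 0)%:R.

Lemma dot_subunit (d : nat -> ell2 R) x k : subunit d ->
  dot x (d k) * dot (d k) (d k) = dot x (d k).
Proof.
move=> [_ ->]; have [->|] := eqVneq (d k) 0; first by rewrite dot0r mul0r.
by rewrite mulr1.
Qed.

(** The projection p of x to the span of d_0, ..., d_{n-1} satisfies
<x - p, p> = 0, so 0 <= |x - p|^2 = |x|^2 - <p, x>. *)
Lemma bessel (d : nat -> ell2 R) x n : subunit d ->
  \sum_(k < n) normc (dot x (d k)) ^+ 2 <= normsq x.
Proof.
move=> dP; set p := \sum_(k < n) dot x (d k) *: d k.
have pd (j : 'I_n) : dot p (d j) = dot x (d j).
  rewrite dot_suml (bigD1 j) //= dotZl dot_subunit // big1 ?addr0 // => i ij.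
  by rewrite dotZl dP.1 ?mulr0.
have xpp : dot (x - p) p = 0.
  by rewrite dot_sumr big1// => j _; rewrite dotZr dotBl pd subrr mulr0.
have px : dot p x = (\sum_(k < n) normc (dot x (d k)) ^+ 2)%:C.
  rewrite dot_suml rmorph_sum /=; apply: eq_bigr => k _.
  by rewrite dotZl (dotC x) -sqr_normcE.
have := dot_ge0 (x - p).
by rewrite [X in 0 <= X]dotBr xpp subr0 dotBl px dotE -rmorphB /= ler0c subr_ge0.
Qed.

Definition truncate x n : ell2 R := \sum_(k < n) x k *: stdvec k.

Lemma cvg_truncate x : (fun n => normsq (x - truncate x n)) @ \oo --> (0 : R).
Proof.
have -> : (fun n => normsq (x - truncate x n)) =
  (fun n => normsq x - \sum_(k < n) normc (x k) ^+ 2).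
  apply/funext => n; apply: complexI; rewrite -dotE rmorphB /= -dotE.
  set t := truncate x n.
  have tx : dot t x = (\sum_(k < n) normc (x k) ^+ 2)%:C.
    rewrite dot_suml rmorph_sum /=; apply: eq_bigr => k _.
    by rewrite dotZl dot_stdvecl -sqr_normcE.
  have xtt : dot (x - t) t = 0.
    rewrite dot_sumr big1// => j _; rewrite dotZr dotBl dot_stdvecr.
    rewrite dot_suml (bigD1 j) //= big1 => [|i ij].
      by rewrite dotZl dot_stdvec eqxx mulr1 addr0 subrr mulr0.
    by rewrite dotZl dot_stdvec val_eqE (negbTE ij) mulr0.
  by rewrite dotBr xtt subr0 dotBl tx.
rewrite -[X in _ --> X](subrr (normsq x)).
by apply: cvgB; [exact: cvg_cst|exact: cvg_normsq].
Qed.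

(** The representing vector is y = (conj (phi e_k))_k.  It is in l2 because, for
its truncation z to n coordinates, phi z = |z|^2, so boundedness of phi gives
|z|^4 <= M |z|^2.  It represents phi because phi is continuous and x is the
limit of its truncations. *)
Lemma riesz (phi : ell2 R -> R[i]) (M : R) :
  (forall a x y, phi (a *: x + y) = a * phi x + phi y) ->
  (forall x, normc (phi x) ^+ 2 <= M * normsq x) ->
  exists y, forall x, phi x = dot x y.
Proof.
move=> phiP phiM.
have phi0 : phi 0 = 0.
  by have := phiP (-1) 0 0; rewrite scaler0 addr0 mulN1r addNr.
have phi_sum n (F : 'I_n -> ell2 R) (c : 'I_n -> R[i]) :
    phi (\sum_(k < n) c k *: F k) = \sum_(k < n) c k * phi (F k).
  elim/big_ind2 : _ => // [x1 ? x2 ? <- <-|i _].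
    by rewrite -[X in phi (X + _)]scale1r phiP mul1r.
  by rewrite -[_ *: _]addr0 phiP phi0 addr0.
pose y k := (phi (stdvec k))^*.
have ybound n : \sum_(k < n) normc (y k) ^+ 2 <= M.
  set Y := \sum_(k < n) _; pose z := \sum_(k < n) y k *: stdvec k.
  have Y0 : 0 <= Y by apply: sumr_ge0 => k _; exact: sqr_ge0.
  have phiz : phi z = Y%:C.
    rewrite phi_sum rmorph_sum /=; apply: eq_bigr => k _.
    by rewrite sqr_normcE /y conjCK.
  have zz : normsq z = Y.
    apply: complexI; rewrite -dotE -phiz phi_sum dot_suml.
    apply: eq_bigr => k _; rewrite dotZl; congr (_ * _).
    rewrite dot_sumr (bigD1 k) //= big1 => [|i ik].
      by rewrite dotZr dot_stdvec eqxx mulr1 addr0 /y conjCK.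
    by rewrite dotZr dot_stdvec val_eqE eq_sym (negbTE ik) mulr0.
  have := phiM z; rewrite phiz zz /= expr0n /= addr0 sqrtr_sqr ger0_norm //.
  rewrite expr2; have [<-|Yn0] := eqVneq 0 Y.
    (* Y = 0: the bound applied to a unit vector shows 0 <= M. *)
    move=> _; have := phiM (stdvec 0); have -> : normsq (stdvec 0) = 1.
      by apply: complexI; rewrite -dotE dot_stdvec eqxx.
    by rewrite mulr1; apply: le_trans; exact: sqr_ge0.
  by rewrite ler_pM2r // lt_neqAle Yn0.
exists (mk_ell2 (square_summable_bounded ybound)) => x.
apply/esym/dot_unique/cvg_normc.
have E n : \sum_(k < n) x k * (y k)^* = phi (truncate x n).
  by rewrite phi_sum; apply: eq_bigr => k _; rewrite /y conjCK.
apply: (@squeeze_cvgr _ _ _ _ (cst 0) (fun n => M * normsq (x - truncate x n))).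
- apply: nearW => n; rewrite sqr_ge0 /= E.
  have -> : phi x - phi (truncate x n) = phi (x - truncate x n).
    by rewrite addrC -mulN1r -phiP scaleN1r addrC.
  exact: phiM.
- exact: cvg_cst.
- by rewrite -[X in _ --> X](mulr0 M); apply: cvgMl_tmp; exact: cvg_truncate.
Qed.

Lemma adjoint (S : ell2 R -> ell2 R) :
  (forall a x y, S (a *: x + y) = a *: S x + S y) ->
  (forall x, normsq (S x) <= normsq x) ->
  exists T : ell2 R -> ell2 R, forall c x, dot (T c) x = dot c (S x).
Proof.
move=> Sl S1.
suff /choice[T TP] : forall c, exists y, forall x, dot (S x) c = dot x y.
  by exists T => c x; rewrite dotC -TP -dotC.
move=> c; apply: (@riesz _ (normsq c)) => [a x y|x]; first by rewrite Sl dotDZl.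
by rewrite mulrC (le_trans (cauchy_schwarz _ _))// ler_wpM2r ?normsq_ge0.
Qed.

Definition bessel_map (d : nat -> ell2 R) (dP : subunit d) x : ell2 R :=
  @mk_ell2 R (fun k => dot x (d k))
    (square_summable_bounded (fun n => bessel x n dP)).

Lemma bessel_adjoint (d : nat -> ell2 R) (dP : subunit d) :
  exists T : ell2 R -> ell2 R,
    forall c x, dot (T c) x = dot c (bessel_map dP x).
Proof.
apply: adjoint => [a x y|x]; first by apply: ell2P => k; exact: dotDZl.
apply: limr_le; first exact: ell2_square_summable.
by apply: nearW => n; rewrite seriesEord; exact: bessel.
Qed.

End Riesz.

(** * Unitaries from orthonormal bases and reflections *)

Section Unitary.
Variable R : realType.
Local Notation stdvec := (@stdvec R).
Implicit Types (x y z : ell2 R) (u v w : unitary R).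

Lemma unitaryDZ u a x y : u (a *: x + y) = a *: u x + u y.
Proof. by case: (unitaryP u) => h _ _; exact: h. Qed.

Lemma unitary0 u : u 0 = 0.
Proof. by have := unitaryDZ u (-1) 0 0; rewrite scaler0 addr0 scaleN1r addNr. Qed.

Lemma unitaryD u x y : u (x + y) = u x + u y.
Proof. by have := unitaryDZ u 1 x y; rewrite !scale1r. Qed.

Lemma unitaryZ u a x : u (a *: x) = a *: u x.
Proof. by have := unitaryDZ u a x 0; rewrite unitary0 !addr0. Qed.

Lemma dot_unitary u x y : dot (u x) (u y) = dot x y.
Proof. by case: (unitaryP u) => _ _ h; exact: h. Qed.

Lemma unitaryM u v x : (u * v)%g x = u (v x). Proof. by []. Qed.

Lemma unitary1 x : (1%g : unitary R) x = x. Proof. by []. Qed.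

Lemma unitaryKV u x : u (u^-1%g x) = x.
Proof. by rewrite -unitaryM mulgV. Qed.

Lemma unitaryVK u x : u^-1%g (u x) = x.
Proof. by rewrite -unitaryM mulVg. Qed.

Lemma dot_unitaryV u x y : dot (u x) y = dot x (u^-1%g y).
Proof. by rewrite -{1}[y](unitaryKV u) dot_unitary. Qed.

(** The operator is the adjoint T of the Bessel map S of b: orthonormality
gives S T = 1, and then S (T S x - x) = 0, so T S = 1 by totality. *)
Lemma unitary_of_basis (b : nat -> ell2 R) :
  (forall i j, dot (b i) (b j) = (i == j)%:R) ->
  (forall x, (forall k, dot x (b k) = 0) -> x = 0) ->
  exists g : unitary R, forall k, g (stdvec k) = b k.
Proof.
move=> bo btotal.
have bP : subunit b.
  split=> [i j /negbTE ij|i]; first by rewrite bo ij.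
  rewrite bo eqxx; case: eqP => // bi0.
  by have := bo i i; rewrite bi0 dot0l eqxx => /esym/eqP; rewrite oner_eq0.
have [T TP] := bessel_adjoint bP; set S := bessel_map bP in TP.
have Sb k : S (b k) = stdvec k by apply: ell2P => j; rewrite stdvecE eq_sym; exact: bo.
have SK : cancel T S.
  by move=> c; apply: ell2P => k; rewrite -[LHS]/(dot (T c) (b k)) TP Sb dot_stdvecr.
have TK : cancel S T.
  move=> x; apply/eqP; rewrite -subr_eq0; apply/eqP/btotal => k.
  by rewrite dotBl -[X in X - _]/(S (T (S x)) k) SK subrr.
have Tl : linear T.
  by move=> a c c'; apply: dot_ext => z; rewrite dotDZl !TP dotDZl.
have Tdot c c' : dot (T c) (T c') = dot c c' by rewrite TP SK.
have TU : unitary_operator T by split=> //; exists S.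
exists (Unitary TU) => k; apply: dot_ext => z.
by rewrite -[LHS]/(dot (T (stdvec k)) z) TP dot_stdvecl [RHS]dotC.
Qed.

(** With S the Bessel map of the normalized family, Q = S^* S is the orthogonal
projection to the closed span of d, and the reflection is 1 - 2 Q. *)
Lemma reflection (d : nat -> ell2 R) :
  (forall i j, i != j -> dot (d i) (d j) = 0) ->
  exists w : unitary R, (forall k, w (d k) = - d k) /\
    forall x, (forall k, dot x (d k) = 0) -> w x = x.
Proof.
move=> dP.
pose n k := (ell2_norm (d k))^-1 *: d k.
have nP : subunit n.
  split=> [i j ij|i]; first by rewrite dotZl dotZr dP// !mulr0.
  by rewrite dot_normalize scaler_eq0 invr_eq0 ell2_norm_eq0 orbb.
have [T TP] := bessel_adjoint nP; set S := bessel_map nP in TP.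
have SE x k : S x k = dot x (n k) by [].
pose Q x := T (S x).
have QP x y : dot (Q x) y = dot (S x) (S y) by rewrite TP.
have Sn k : S (n k) = dot (n k) (n k) *: stdvec k.
  apply: ell2P => j; rewrite SE ell2Z stdvecE.
  by have [->|jk] := eqVneq j k; rewrite ?mulr1// mulr0 nP.1 // eq_sym.
have SQ x : S (Q x) = S x.
  apply: ell2P => k; rewrite [LHS]SE TP Sn.
  by rewrite dotZr dot_stdvecr -dotC mulrC SE dot_subunit.
have QQ x : Q (Q x) = Q x by apply: dot_ext => z; rewrite !QP SQ.
have Ql a x y : Q (a *: x + y) = a *: Q x + Q y.
  apply: dot_ext => z; rewrite dotDZl !QP -dotDZl; congr (dot _ _).
  by apply: ell2P => k; exact: dotDZl.
have Q0 : Q 0 = 0 by have := Ql (-1) 0 0; rewrite scaler0 addr0 scaleN1r addNr.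
have QC x y : dot x (Q y) = dot (Q x) y by rewrite dotC !QP -dotC.
pose W x := (-2) *: Q x + x.
have QW x : Q (W x) = - Q x.
  by rewrite Ql QQ scaleNr scaler_nat mulr2n opprD -addrA addNr addr0.
have Wl : linear W.
  move=> a x y; rewrite /W Ql [a *: (_ + x)]scalerDr !scalerDr !scalerA mulrC.
  by rewrite addrACA.
have WK : involutive W.
  move=> x; rewrite {1}/W QW scaleNr scalerN opprK /W scaleNr.
  by rewrite addrA subrr add0r.
have c2 : (-2 : R[i])^* = -2 by rewrite rmorphN /= conjC_nat.
have Wdot x y : dot (W x) (W y) = dot x y.
  rewrite /W dotDr !dotDl !dotZr !dotZl c2 !QC QQ.
  by ring.
have WU : unitary_operator W by split=> //; exists W.
have WE x : Unitary WU x = (-2) *: Q x + x by [].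
exists (Unitary WU); split=> [k|x xd]; rewrite WE.
  have dn : d k = ell2_norm (d k) *: n k + 0.
    rewrite addr0 /n scalerA; have [->|dk0] := eqVneq (d k) 0.
      by rewrite scaler0.
    by rewrite divff ?scale1r ?ell2_norm_eq0.
  have Qn : Q (n k) = n k.
    apply: dot_ext => z; rewrite QP Sn dotZl dot_stdvecl SE -dotC nP.2.
    by have [->|] := eqVneq (n k) 0; rewrite ?dot0l ?mulr0// mul1r.
  suff -> : Q (d k) = d k.
    by rewrite scaleNr scaler_nat mulr2n opprD -addrA addNr addr0.
  by rewrite dn Ql Qn Q0.
suff -> : Q x = 0 by rewrite scaler0 add0r.
apply: dot_ext => z; rewrite QP.
have -> : S x = 0 by apply: ell2P => k; rewrite SE dotZr xd mulr0.
by rewrite !dot0l.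
Qed.

End Unitary.

(** * Pointwise stabilizers of sets of basis vectors *)

Section Stabilizers.
Variable R : realType.
Local Notation stdvec := (@stdvec R).
Implicit Types (x y z : ell2 R) (u v w g : unitary R) (A B : set nat).

Definition fixes A u : Prop := forall j, A j -> u (stdvec j) = stdvec j.

Definition supported A x : Prop := forall j, ~ A j -> x j = 0.

Lemma fixesV A u : fixes A u -> fixes A u^-1%g.
Proof. by move=> hu j Aj; rewrite -{1}(hu j Aj) unitaryVK. Qed.

(** Comparing coordinates gives <u x, x> = <x, x>: those in A agree because
u^-1 also fixes e_j, the others are multiplied by 0.  Hence |u x - x|^2 = 0. *)
Lemma fixes_supported A u x : fixes A u -> supported A x -> u x = x.
Proof.
move=> uA xA; apply/eqP; rewrite -subr_eq0; apply/eqP/dot_eq0.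
have uxx : dot (u x) x = dot x x.
  apply: dot_unique; rewrite (_ : (fun n => _) =
    (fun n => \sum_(k < n) x k * (x k)^* : R[i]^o)); first exact: cvg_dot.
  apply/funext => n; apply: eq_bigr => -[k /= _] _.
  have [Ak|Ak] := pselect (A k); last by rewrite (xA _ Ak) conjC0 !mulr0.
  by rewrite -dot_stdvecr dot_unitaryV (fixesV uA) // dot_stdvecr.
by rewrite dotBr !dotBl dot_unitary (dotC (u x)) uxx -dotC !subrr.
Qed.

Lemma fixes_preserves A u x : fixes (~` A) u -> supported A x -> supported A (u x).
Proof.
move=> uA xA j Aj.
by rewrite -dot_stdvecr dot_unitaryV (fixesV uA) // dot_stdvecr xA.
Qed.

Lemma supported_stdvec A j : A j -> supported A (stdvec j).
Proof.
by move=> Aj k Ak; rewrite stdvecE; case: eqP => // kj; case: Ak; rewrite kj.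
Qed.

Lemma dot_supported A x y : supported A x -> supported (~` A) y -> dot x y = 0.
Proof.
move=> xA yA; apply: dot_unique.
rewrite (_ : (fun _ => _) = cst 0); first exact: cvg_cst.
apply/funext => n /=; rewrite big1 // => k _.
have [Ak|Ak] := pselect (A k); last by rewrite (xA _ Ak) mul0r.
by rewrite (yA k) ?conjC0 ?mulr0.
Qed.

Lemma unitary_eq u v : (forall j, u (stdvec j) = v (stdvec j)) -> u = v.
Proof.
move=> uv; apply: unitary_ext => x.
have vu : fixes setT (v^-1 * u)%g.
  by move=> j _; rewrite unitaryM uv unitaryVK.
have e : (v^-1 * u)%g x = x by apply: (fixes_supported vu) => j /(_ I).
by rewrite -[X in _ = v X]e unitaryM unitaryKV.
Qed.

Lemma unitary_of_bij (s : nat -> nat) : bijective s ->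
  exists g : unitary R, forall j, g (stdvec j) = stdvec (s j).
Proof.
move=> [t sK tK]; apply: unitary_of_basis => [i j|x xs].
  by rewrite dot_stdvec (can_eq sK).
by apply: ell2P => j; rewrite -dot_stdvecr -(tK j) xs.
Qed.

(** The map t |-> u_t is a family of unitaries of the coordinate subspaces of
the blocks {j | p j = t}, and g is their direct sum. *)
Lemma unitary_direct_sum (T : Type) (p : nat -> T) (u : T -> unitary R) :
  (forall t, fixes [set j | p j <> t] (u t)) ->
  exists g : unitary R, forall j, g (stdvec j) = u (p j) (stdvec j).
Proof.
move=> up.
have pre t j : p j = t -> supported [set j | p j = t] (u t (stdvec j)).
  move=> pj; apply: fixes_preserves (supported_stdvec _); last exact: pj.
  by move=> k /= pk; exact: up.
apply: unitary_of_basis => [i j|x xb].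
  have [pij|pij] := pselect (p i = p j); first by rewrite pij dot_unitary dot_stdvec.
  have -> : (i == j) = false by apply/eqP => ij; apply: pij; rewrite ij.
  apply: (@dot_supported [set k | p k = p i]); first exact: pre.
  move=> k /= /contrapT pk; apply: (pre (p j)) => //=.
  by rewrite pk.
(* Totality: if x is orthogonal to all the vectors then u_t^-1 x vanishes on the
   block of t, so u_t fixes it and x itself vanishes there. *)
apply: ell2P => j; have := xb j.
rewrite -[x](unitaryKV (u (p j))) dot_unitary dot_stdvecr => xj.
have hV := fixesV (up (p j)).
have [] := pselect (supported [set k | p k <> p j] ((u (p j))^-1%g x)).
  by move/(fixes_supported (up (p j))) => ->.
case=> k /= /contrapT pk; have := xb k; rewrite pk.
by rewrite -{1}[x](unitaryKV (u (p j))) dot_unitary dot_stdvecr.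
Qed.

(** The reflection in the span of the a_k - b_k fixes a_k + b_k, as equal
norms make it orthogonal to a_k - b_k, and therefore exchanges a_k and b_k. *)
Lemma unitary_swap (a b : nat -> ell2 R) :
  (forall i j, dot (a i) (a j) = dot (b i) (b j)) ->
  (forall i j, i != j -> dot (a i) (a j) = 0) ->
  (forall i j, dot (a i) (b j) = 0) ->
  exists w : unitary R, (forall k, w (a k) = b k) /\
    forall x, (forall k, dot x (a k) = 0) -> (forall k, dot x (b k) = 0) ->
      w x = x.
Proof.
move=> aabb aa ab.
have ba i j : dot (b i) (a j) = 0 by rewrite dotC ab conjC0.
have [i j ij|w [wd wx]] := @reflection R (fun k => a k - b k).
  by rewrite dotBr !dotBl ab ba -aabb aa // !subrr.
exists w; split=> [k|x xa xb]; last first.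
  by apply: wx => k; rewrite dotBr xa xb subrr.
have wp : w (a k + b k) = a k + b k.
  by apply: wx => i; rewrite dotBr !dotDl ab ba aabb addr0 add0r subrr.
apply: (@scalerI _ _ (2 : R[i])); first by rewrite pnatr_eq0.
rewrite -unitaryZ.
have -> : 2 *: a k = (a k + b k) + (a k - b k).
  by rewrite addrACA subrr addr0 scaler_nat mulr2n.
by rewrite unitaryD wp wd opprB [a k + _]addrC addrACA subrr addr0 scaler_nat mulr2n.
Qed.

End Stabilizers.

(** * Factorization through stabilizers of coordinate subspaces *)

Lemma sequence_of_prefix (T : Type) (P : seq T -> T -> Prop) :
  (forall s, exists t, P s t) -> exists f : nat -> T, forall n, P (mkseq f n) (f n).
Proof.
move=> /choice[g gP].
pose pre := fix pre n := if n is n'.+1 then rcons (pre n') (g (pre n')) else [::].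
have preE n : mkseq (g \o pre) n = pre n.
  by elim: n => // n IH; rewrite mkseqS IH.
by exists (g \o pre) => n; rewrite preE; exact: gP.
Qed.

Section Selection.
Variable R : realType.
Local Notation stdvec := (@stdvec R).
Implicit Types (x y z : ell2 R) (u v w g : unitary R) (A B : set nat).

(** Among the combinations of n + 1 basis vectors indexed by A there is a nonzero
one orthogonal to n given vectors. *)
Lemma exists_unit_avoiding A (s : seq (ell2 R)) : infinite_set A ->
  exists f, [/\ supported A f, dot f f = 1 & forall y, y \in s -> dot f y = 0].
Proof.
move=> /infinite_nat_enum[nu [nuI nuA _]].
pose n := size s.
pose M : 'M[R[i]]_(n.+1, n) := \matrix_(i, j) dot (stdvec (nu i)) (nth 0 s j).
have : kermx M != 0.
  by rewrite -mxrank_eq0 mxrank_ker subn_eq0 -ltnNge ltnS rank_leq_col.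
case/rowV0Pn => v /sub_kermxP vM v0.
pose f := \sum_(i < n.+1) v 0 i *: stdvec (nu i).
have fs y : y \in s -> dot f y = 0.
  move=> ys; have js : (index y s < n)%N by rewrite index_mem.
  have /matrixP/(_ 0 (Ordinal js)) := vM; rewrite !mxE => <-.
  by rewrite dot_suml; apply: eq_bigr => i _; rewrite dotZl mxE /= nth_index.
have f0 : f != 0.
  apply: contra_neq v0 => f0; apply/rowP => i; rewrite [RHS]mxE.
  have := dot0l (stdvec (nu i)); rewrite -f0 dot_suml (bigD1 i) //= big1 => [|j ji].
    by rewrite dotZl dot_stdvec eqxx mulr1 addr0.
  by rewrite dotZl dot_stdvec (inj_eq nuI) val_eqE (negbTE ji) mulr0.
exists ((ell2_norm f)^-1 *: f); split=> [j Aj||y ys].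
- rewrite ell2Z ell2_sum big1 ?mulr0 // => i _; rewrite ell2Z stdvecE.
  by case: eqP => [ji|]; rewrite ?mulr0 //; case: Aj; rewrite ji.
- by rewrite dot_normalize f0.
- by rewrite dotZl fs ?mulr0.
Qed.

Lemma coord_proj_bound A x n :
  \sum_(k < n) normc (if `[< A k >] then x k else 0) ^+ 2 <= normsq x.
Proof.
apply: le_trans (normsq_ge_partial x n); apply: ler_sum => k _.
by case: ifP => // _; rewrite normc0 expr0n sqr_ge0.
Qed.

Definition coord_proj A x : ell2 R :=
  @mk_ell2 R (fun k => if `[< A k >] then x k else 0)
    (square_summable_bounded (coord_proj_bound A x)).

Lemma coord_proj_supported A x : supported A (coord_proj A x).
Proof.
by move=> j /asboolPn Aj; rewrite /coord_proj /mk_ell2 /ell2_seq (negbTE Aj).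
Qed.

Lemma coord_proj_compl A x : supported (~` A) (x - coord_proj A x).
Proof.
move=> j /contrapT Aj; rewrite ell2D ell2N /coord_proj /mk_ell2 {2}/ell2_seq.
by rewrite asboolT // subrr.
Qed.

Arguments coord_proj_supported : clear implicits.
Arguments coord_proj_compl : clear implicits.

Lemma dot_coord_proj A x y : supported A y -> dot (coord_proj A x) y = dot x y.
Proof.
move=> yA; apply/eqP; rewrite eq_sym -subr_eq0 -dotBl; apply/eqP/dot_eq0C.
exact: dot_supported yA (coord_proj_compl _ _).
Qed.

(** Each new pair (f_k, h_k) only has to be orthogonal to finitely many vectors:
f_k to f_i, u^-1 P u f_i and u^-1 h_i for i < k, and h_k to h_i and u f_i for
i <= k. *)
Lemma sparse_sequences A B (us : seq (unitary R)) : infinite_set B ->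
  exists f h : nat -> ell2 R,
  [/\ forall i j, dot (f i) (f j) = (i == j)%:R,
      forall i j, dot (h i) (h j) = (i == j)%:R,
      forall k, supported B (h k),
      forall u, u \in us -> forall i j, i != j ->
        dot (coord_proj A (u (f i))) (coord_proj A (u (f j))) = 0 &
      forall u, u \in us -> forall i j, dot (u (f i)) (h j) = 0].
Proof.
move=> Binf.
pose P (s : seq (ell2 R * ell2 R)) (t : ell2 R * ell2 R) :=
  [/\ dot t.1 t.1 = 1, dot t.2 t.2 = 1, supported B t.2,
      forall u, u \in us -> dot (u t.1) t.2 = 0 &
      forall r, r \in s -> [/\ dot t.1 r.1 = 0, dot t.2 r.2 = 0 &
        forall u, u \in us -> [/\ dot (u t.1) (coord_proj A (u r.1)) = 0,
          dot (u t.1) r.2 = 0 & dot t.2 (u r.1) = 0]]].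
have [s|t tP] := @sequence_of_prefix _ P.
  have [f [_ ff fs]] := exists_unit_avoiding
    ([seq r.1 | r <- s] ++
     [seq (u^-1)%g (coord_proj A (u r.1)) | r <- s, u <- us] ++
     [seq (u^-1)%g r.2 | r <- s, u <- us]) infinite_nat.
  have [h [hB hh hs]] := exists_unit_avoiding
    ([seq r.2 | r <- s] ++ [seq (u : unitary R) r.1 | r <- s, u <- us] ++
     [seq (u : unitary R) f | u <- us]) Binf.
  exists (f, h); split=> //= [u uus|r rs].
    by apply/dot_eq0C/hs; rewrite !mem_cat; apply/or3P/Or33/mapP; exists u.
  split=> [||u uus].
  - by apply: fs; rewrite !mem_cat; apply/or3P/Or31/mapP; exists r.
  - by apply: hs; rewrite !mem_cat; apply/or3P/Or31/mapP; exists r.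
  - split.
    + rewrite dot_unitaryV; apply: fs; rewrite !mem_cat; apply/or3P/Or32.
      by apply/allpairsP; exists (r, u).
    + rewrite dot_unitaryV; apply: fs; rewrite !mem_cat; apply/or3P/Or33.
      by apply/allpairsP; exists (r, u).
    + apply: hs; rewrite !mem_cat; apply/or3P/Or32.
      by apply/allpairsP; exists (r, u).
have prev i j : (i < j)%N -> t i \in mkseq t j.
  by move=> ij; apply/mapP; exists i; rewrite ?mem_iota.
have sym (F : nat -> nat -> R[i]) : (forall i j, F j i = (F i j)^*) ->
    (forall i j, (i < j)%N -> F j i = 0) -> forall i j, i != j -> F i j = 0.
  move=> FC F0 i j; rewrite neq_ltn => /orP[ij|ji]; last exact: F0.
  by rewrite FC F0 // conjC0.
have diag (F : nat -> ell2 R) : (forall i, dot (F i) (F i) = 1) ->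
    (forall i j, (i < j)%N -> dot (F j) (F i) = 0) ->
    forall i j, dot (F i) (F j) = (i == j)%:R.
  move=> F1 F0 i j; have [->|ij] := eqVneq i j; first exact: F1.
  by apply: (sym (fun i j => dot (F i) (F j))) ij => // *; exact: dotC.
exists (fun k => (t k).1), (fun k => (t k).2); split.
- apply: diag => [i|i j /prev ij]; first by case: (tP i).
  by case: (tP j) => _ _ _ _ /(_ _ ij)[].
- apply: diag => [i|i j /prev ij]; first by case: (tP i).
  by case: (tP j) => _ _ _ _ /(_ _ ij)[].
- by move=> k; case: (tP k).
- move=> u uus; apply: sym => [i j|i j /prev ij]; first exact: dotC.
  rewrite dot_coord_proj; last exact: coord_proj_supported.
  by case: (tP j) => _ _ _ _ /(_ _ ij)[_ _ /(_ _ uus)[]].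
- move=> u uus i j; case: (ltngtP i j) => [/prev ij|/prev ji|->].
  + by apply: dot_eq0C; case: (tP j) => _ _ _ _ /(_ _ ij)[_ _ /(_ _ uus)[]].
  + by case: (tP i) => _ _ _ _ /(_ _ ji)[_ _ /(_ _ uus)[]].
  + by case: (tP j) => _ _ _ /(_ _ uus).
Qed.

End Selection.

Section Factorization.
Variable R : realType.
Local Notation stdvec := (@stdvec R).
Implicit Types (x y z : ell2 R) (u v w g : unitary R) (A B : set nat).

Lemma supportedS A B x : A `<=` B -> supported A x -> supported B x.
Proof. by move=> AB xA j Bj; apply: xA => /AB. Qed.

Lemma supportedD A x y : supported A x -> supported A y -> supported A (x + y).
Proof. by move=> xA yA j Aj; rewrite ell2D xA // yA // addr0. Qed.

Lemma supportedZ A a x : supported A x -> supported A (a *: x).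
Proof. by move=> xA j Aj; rewrite ell2Z xA // mulr0. Qed.

(** The h_k, which live on the block 3, are an intermediate stop: exchanging
P f_k with a multiple of h_k inside l2(X) clears the blocks 1 and 2, so that the
result can be exchanged with basis vectors of the block 1 without touching the
block 2. *)
Lemma sparse_to_basis (p nu : nat -> nat) (f h : nat -> ell2 R) :
  let X := [set j | p j <> 0%N] in
  injective nu -> (forall k, p (nu k) = 1%N) ->
  (forall i j, dot (h i) (h j) = (i == j)%:R) ->
  (forall k, supported [set j | p j = 3%N] (h k)) ->
  (forall i j, dot (f i) (f j) = (i == j)%:R) ->
  (forall i j, i != j -> dot (coord_proj X (f i)) (coord_proj X (f j)) = 0) ->
  (forall i j, dot (f i) (h j) = 0) ->
  exists a b : unitary R, [/\ fixes [set j | p j = 0%N] a,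
    fixes [set j | p j = 2%N] b & forall k, b (a (f k)) = stdvec (nu k)].
Proof.
move=> X nuI nu1 hh hB ff Pff fh.
have hX k : supported X (h k) by apply: supportedS (hB k) => j /= pj; rewrite /X /= pj.
pose m k := ell2_norm (coord_proj X (f k)).
have [||i j|a [aE ax]] :=
  @unitary_swap R (fun k => coord_proj X (f k)) (fun k => m k *: h k).
- move=> i j; rewrite dotZl dotZr hh.
  have [->|ij] := eqVneq i j; last by rewrite Pff // !mulr0.
  by rewrite mulr1 conj_ell2_norm sqr_ell2_norm.
- exact: Pff.
- by rewrite dotZr dot_coord_proj // fh mulr0.
pose c k := f k - coord_proj X (f k).
have cY k : supported (~` X) (c k) by exact: coord_proj_compl.
have ac k : a (c k) = c k.
  apply: ax => i; apply: dot_eq0C; apply: (@dot_supported _ X) (cY k) => //.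
    exact: coord_proj_supported.
  exact: supportedZ.
pose g k := m k *: h k + c k.
have af k : a (f k) = g k.
  by rewrite -{1}(subrK (coord_proj X (f k)) (f k)) unitaryD ac aE addrC.
have gS k : supported [set j | p j = 0%N \/ p j = 3%N] (g k).
  apply: supportedD.
    by apply: supportedS (supportedZ _ (hB k)) => j /= ->; right.
  by apply: supportedS (cY k) => j /contrapT; left.
have [i j|i j|i j|b [bE bx]] := @unitary_swap R g (stdvec \o nu).
- by rewrite -!af dot_unitary ff dot_stdvec (inj_eq nuI).
- by rewrite -!af dot_unitary ff => /negbTE ->.
- by rewrite dot_stdvecr gS //= nu1; case.
exists a, b; split=> [j pj|j pj|k]; last by rewrite af bE.
- have Xj : ~ X j by rewrite /X /= pj => /(_ erefl).
  apply: ax => k; rewrite dot_stdvecl.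
    by rewrite (@coord_proj_supported _ X _ _ Xj) conjC0.
  by rewrite (supportedZ _ (hX k) Xj) conjC0.
- apply: bx => k; rewrite dot_stdvecl; first by rewrite gS ?conjC0 //= pj; case.
  by rewrite stdvecE; case: eqP pj => [-> /=|_ _]; rewrite ?nu1// conjC0.
Qed.

(** Sequences that are sparse for both 1 and u yield p = b a with p f_k = e_nu(k)
and q = b' a' with q u f_k = e_nu(k); then q u p^-1 fixes the block 1. *)
Lemma unitary_factorization (p : nat -> nat) u :
  (forall n, infinite_set [set j | p j = n]) ->
  exists a b c d e : unitary R,
  [/\ fixes [set j | p j = 0%N] a, fixes [set j | p j = 2%N] b,
      fixes [set j | p j = 1%N] c, fixes [set j | p j = 2%N] d &
      fixes [set j | p j = 0%N] e] /\ u = (a * b * c * d * e)%g.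
Proof.
move=> pinf; have [nu [nuI nu1 nuS]] := infinite_nat_enum (pinf 1%N).
have [f [h [ff hh hB Pf fh]]] :=
  sparse_sequences [set j | p j <> 0%N] [:: 1%g; u] (pinf 3).
have h1 : 1%g \in [:: 1%g; u] by rewrite !inE eqxx.
have hu : u \in [:: 1%g; u] by rewrite !inE eqxx orbT.
have [a [b [aF bF abE]]] :=
  sparse_to_basis nuI nu1 hh hB ff (Pf _ h1) (fh _ h1).
have uff i j : dot (u (f i)) (u (f j)) = (i == j)%:R by rewrite dot_unitary.
have [a' [b' [aF' bF' abE']]] :=
  sparse_to_basis nuI nu1 hh hB uff (Pf _ hu) (fh _ hu).
exists (a'^-1)%g, (b'^-1)%g, (b' * a' * u * a^-1 * b^-1)%g, b, a; split.
  split=> //; try exact: fixesV.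
  move=> _ /nuS[k <-]; rewrite !unitaryM -[in LHS]abE !unitaryVK.
  exact: abE'.
by apply: unitary_ext => x; rewrite !unitaryM !unitaryVK.
Qed.

End Factorization.

(** * The shift swindle *)

Section Swindle.
Variable R : realType.
Local Notation stdvec := (@stdvec R).
Implicit Types (x y z : ell2 R) (u v w g : unitary R) (A B : set nat).

Lemma fixes_commute A u v : fixes A u -> fixes (~` A) v -> (u * v = v * u)%g.
Proof.
move=> uA vA; apply: unitary_eq => j; rewrite !unitaryM.
have [Aj|Aj] := pselect (A j).
  rewrite (uA _ Aj); apply: fixes_supported uA _.
  by apply: fixes_preserves vA _; exact: supported_stdvec.
rewrite (vA _ Aj); apply/esym/(fixes_supported vA)/fixes_preserves.
  by rewrite setCK.
exact: supported_stdvec.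
Qed.

Lemma fixesS A B u : A `<=` B -> fixes B u -> fixes A u.
Proof. by move=> AB uB j /AB; exact: uB. Qed.

(** D j is the number of shifts that lead from the support of u to j, if any.
With v the direct sum of the g^i u g^-i for i >= 0, conjugation by g removes the
term i = 0, which is u. *)
Lemma shift_commutator (s : nat -> nat) (D : nat -> option nat) g u :
  bijective s -> (forall j, g (stdvec j) = stdvec (s j)) ->
  (forall j, D (s j) = if D j is Some i then Some i.+1 else
     if D (s j) is Some 0 then Some 0%N else None) ->
  fixes [set j | D j <> Some 0%N] u ->
  exists2 v, fixes [set j | D j = None] v & (u * (g * v * g^-1))%g = v.
Proof.
move=> [t sK tK] gE Ds uF.
have gV j : g^-1%g (stdvec j) = stdvec (t j) by rewrite -{1}(tK j) -gE unitaryVK.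
pose U := fix U i := if i is i'.+1 then (g * U i' * g^-1)%g else u.
have UF i : fixes [set j | D j <> Some i] (U i).
  elim: i => // i IH j Dj.
  rewrite -[U i.+1]/(g * U i * g^-1)%g !unitaryM gV IH ?gE ?tK //= => Dt.
  by apply: Dj; rewrite -(tK j) Ds Dt.
have [|v vE] := @unitary_direct_sum R _ D
  (fun o => if o is Some i then U i else 1%g).
  by case=> [i|] //= j /= Dj; exact: UF.
exists v; first by move=> j /= Dj; rewrite vE Dj.
apply: unitary_eq => j; rewrite !unitaryM gV !vE.
have := Ds (t j); rewrite tK.
case Dt : (D (t j)) => [i|] Dj; rewrite Dj.
  have -> : g (U i (stdvec (t j))) = U i.+1 (stdvec j).
    by rewrite -[U i.+1]/(g * U i * g^-1)%g !unitaryM gV.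
  apply: (fixes_supported uF).
  apply: (@supportedS _ [set k | D k = Some i.+1]); first by move=> k /= ->.
  apply: (@fixes_preserves _ _ (U i.+1)); last exact: supported_stdvec.
  by move=> k kD; exact: UF.
rewrite unitary1 gE tK; case Dj' : (D j) Dj => [[|i]|] //= _.
by rewrite uF //= Dj'.
Qed.

End Swindle.

(** * Exhausting chains of subsets of the unitary group *)

Definition exhausting_chain (G : groupType) (W : nat -> set G) : Prop :=
  [/\ forall n, W n `<=` W n.+1, forall g, exists n, W n g,
      forall n x y, W n x -> W n y -> W n.+1 (x * y)%g &
      forall n x, W n x -> W n x^-1%g].

Definition chain_bounded (G : groupType) (W : nat -> set G) (S : set G) : Prop :=
  exists n, S `<=` W n.

Lemma chain_mono (G : groupType) (W : nat -> set G) m n :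
  exhausting_chain W -> (m <= n)%N -> W m `<=` W n.
Proof.
move=> [Wn _ _ _] /subnK <-; elim: (n - m)%N => // k IH.
exact: subset_trans IH (Wn _).
Qed.

Lemma chain_boundedM (G : groupType) (W : nat -> set G) (S T : set G) :
  exhausting_chain W -> chain_bounded W S -> chain_bounded W T ->
  chain_bounded W [set g | exists2 x, S x & exists2 y, T y & g = (x * y)%g].
Proof.
move=> WP [m Sm] [n Tn]; exists (maxn m n).+1 => _ [x Sx [y Ty ->]].
case: (WP) => _ _ WM _; apply: WM.
  by apply: (chain_mono WP (leq_maxl m n)); exact: Sm.
by apply: (chain_mono WP (leq_maxr m n)); exact: Tn.
Qed.

Section Main.
Variable R : realType.
Local Notation stdvec := (@stdvec R).
Implicit Types (x y z : ell2 R) (u v w g : unitary R) (A B : set nat).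

(** If the piece n were not full for W_n, for any n, the direct sum g of the
witnesses u_n would be in no W_n: g extends u_n, and w = u_n^-1 g fixes the
piece n. *)
Lemma chain_full_piece (W : nat -> set (unitary R)) (p : nat -> nat) :
  exhausting_chain W ->
  exists n, forall u, fixes [set j | p j <> n] u ->
    exists2 w, fixes [set j | p j = n] w & W n (u * w)%g.
Proof.
move=> [_ Wall _ _]; apply: contrapT => /forallNP none.
have /choice[u uP] : forall n, exists u, fixes [set j | p j <> n] u /\
    forall w, fixes [set j | p j = n] w -> ~ W n (u * w)%g.
  move=> n; have /existsNP[u /not_implyP[uF uW]] := none n.
  by exists u; split=> // w wF Ww; apply: uW; exists w.
have [g gE] := unitary_direct_sum (fun n => (uP n).1).
have [n Wg] := Wall g; have [_ /(_ ((u n)^-1 * g)%g)] := uP n.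
rewrite mulVKg; apply=> // j pj.
by rewrite unitaryM gE pj unitaryVK.
Qed.

(** For u on the copy (n, 0) of the full piece n, the swindle yields v with
u (g v g^-1) = v, and fullness yields v w in W_n with w trivial on the piece.
As w commutes with the shift g, u = (v w) g (v w)^-1 g^-1. *)
Lemma chain_bounded_small (W : nat -> set (unitary R)) : exhausting_chain W ->
  exists2 A, infinite_set A /\ infinite_set (~` A) &
    chain_bounded W [set u | fixes A u].
Proof.
move=> WP.
(* Indices are triples: the piece n, the position z on the line of shifted
   copies, and the index k inside a copy. *)
have [|psi [phi psiK phiK]] := @bij_nat (nat * int * nat)%type.
  by apply: (@infinite_of_inj _ (fun k => (0%N, 0, k))) => // k k' [].
have inf c : infinite_set [set j | (phi j).1 = c].
  apply: (@infinite_of_inj _ (fun k => psi (c, k))) => [k k' /(can_inj psiK)[]//|k /=].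
  by rewrite psiK.
have [n full] := chain_full_piece (fun j => (phi j).1.1) WP.
exists [set j | (phi j).1 <> (n, 0)].
  split; last by apply: sub_infinite_set (inf (n, 0)) => j /= -> /(_ erefl).
  by apply: sub_infinite_set (inf (n, 1)) => j /= ->.
pose sh (t : nat * int * nat) :=
  ((t.1.1, if t.1.1 == n then t.1.2 + 1 else t.1.2), t.2).
pose hs (t : nat * int * nat) :=
  ((t.1.1, if t.1.1 == n then t.1.2 - 1 else t.1.2), t.2).
have shK : cancel sh hs.
  by move=> [[m z] k]; rewrite /sh /hs /=; case: eqP => // _; rewrite addrK.
have hsK : cancel hs sh.
  by move=> [[m z] k]; rewrite /sh /hs /=; case: eqP => // _; rewrite subrK.
pose s := psi \o sh \o phi.
have sB : bijective s.
  by exists (psi \o hs \o phi) => j; rewrite /s /= psiK ?shK ?hsK phiK.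
have [g gE] := @unitary_of_bij R s sB.
pose D j : option nat := if (phi j).1.1 == n then
  (if (phi j).1.2 is Posz i then Some i else None) else None.
have Ds j : D (s j) = if D j is Some i then Some i.+1 else
     if D (s j) is Some 0 then Some 0%N else None.
  rewrite /D /s /= psiK /sh /=; case: (phi j) => [[m z] k] /=.
  case: eqP => //= _; by case: z => [i|[|i]] //=; rewrite addn1.
have [_ Wall WM WV] := WP; have [m Wg] := Wall g.
exists (maxn n m).+2 => u uF.
have [|v vF uv] := shift_commutator sB gE Ds (u := u).
  by move=> j /= Dj; apply: uF => /= pj; apply: Dj; rewrite /D pj eqxx.
have [|w wF Wa] := full v.
  by move=> j /= pj; apply: vF => /=; rewrite /D; case: eqP.
have gF : fixes [set j | (phi j).1.1 <> n] g.
  move=> j /= pj; rewrite gE /s /= /sh; case: eqP => // _.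
  by case E : (phi j) => [[a b] c] /=; rewrite -E phiK.
have gw : (g * w = w * g)%g.
  by apply: fixes_commute gF _; apply: fixesS wF => j /=; exact: contrapT.
have -> : u = ((v * w) * g * ((v * w)^-1 * g^-1))%g.
  have {1}<- : (v * (g * v * g^-1)^-1)%g = u by rewrite -{1}uv mulgK.
  by rewrite !invgM invgK -!mulgA [in RHS](mulgA w g) -gw -!mulgA mulVKg.
have Wa' : W (maxn n m) (v * w)%g by apply: (chain_mono WP (leq_maxl n m)).
have Wg' : W (maxn n m) g by apply: (chain_mono WP (leq_maxr n m)).
by apply: (WM); apply: WM => //; exact: WV.
Qed.

End Main.

(** A permutation of the basis conjugates Fix(A) into Fix(B) for the moiety B
of [chain_bounded_small], and lies in some W_m. *)
Lemma chain_bounded_fixes (R : realType) (W : nat -> set (unitary R)) A :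
  exhausting_chain W -> infinite_set A -> infinite_set (~` A) ->
  chain_bounded W [set u | fixes A u].
Proof.
move=> WP Ainf cAinf; have [B [Binf cBinf] [n Bn]] := chain_bounded_small WP.
have inf (C : set nat) (Cinf : infinite_set C) (cCinf : infinite_set (~` C)) (t : bool) :
    infinite_set [set j | `[< C j >] = t].
  by case: t; [apply: sub_infinite_set Cinf => j /asboolT |
               apply: sub_infinite_set cCinf => j /asboolF].
have [s [sB sE]] := bij_of_fibers (inf A Ainf cAinf) (inf B Binf cBinf).
have [g gE] := @unitary_of_bij R s sB; have [t sK tK] := sB.
have [_ Wall WM WV] := WP; have [m Wg] := Wall g.
exists (maxn n m).+2 => u uA.
have -> : u = (g^-1 * (g * u * g^-1) * g)%g.
  by rewrite -!mulgA mulVg mulg1 mulKg.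
have Wm : W (maxn n m) g by apply: (chain_mono WP (leq_maxr n m)).
apply: (WM); last exact: chain_mono WP (leqnSn _) _ Wm.
apply: WM; first exact: WV.
apply: (chain_mono WP (leq_maxl n m)); apply: Bn => j Bj.
have gV : g^-1%g (stdvec j) = stdvec (t j).
  by rewrite -{1}(tK j) -gE unitaryVK.
rewrite !unitaryM gV uA ?gE ?tK //.
by apply/asboolP; rewrite -sE tK; exact/asboolP.
Qed.

Lemma chain_bounded_unitary (R : realType) (W : nat -> set (unitary R)) :
  exhausting_chain W -> exists n, W n = setT.
Proof.
move=> WP; have [p pinf] := infinite_partition_nat.
have row n : chain_bounded W [set u : unitary R | fixes [set j | p j = n] u].
  apply: chain_bounded_fixes => //.
  by apply: sub_infinite_set (pinf n.+1) => j /= -> /esym/n_Sn.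
have [n Wn] := chain_boundedM WP (chain_boundedM WP (chain_boundedM WP
  (chain_boundedM WP (row 0) (row 2)) (row 1)) (row 2)) (row 0).
exists n; apply/seteqP; split=> // u _.
have [a [b [c [d [e [[aF bF cF dF eF] ->]]]]]] := unitary_factorization u pinf.
apply: Wn; exists (a * b * c * d)%g; last by exists e.
exists (a * b * c)%g; last by exists d.
exists (a * b)%g; last by exists c.
by exists a => //; exists b.
Qed.

(** A diagonal operator whose n-th entry is 1 or -1, whichever makes it differ
from the n-th unitary of the enumeration at e_n, is not enumerated. *)
Lemma uncountable_unitary (R : realType) : ~ countable [set: unitary R].
Proof.
move=> /countable_injP[f fI].
have /choice[h hP] : forall n, exists u : unitary R, forall v, f v = n -> v = u.
  move=> n; have [[u un]|none] := pselect (exists u : unitary R, f u = n).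
    by exists u => v vn; apply: fI; rewrite ?inE// un.
  by exists 1%g => v vn; case: none; exists v.
pose e n : R[i] := if h n (stdvec n) == stdvec n then -1 else 1.
have e1 n : (e n)^* * e n = 1.
  by rewrite /e; case: ifP => _; rewrite ?rmorphN rmorph1 ?mulrNN mulr1.
have [i j|x xe|d dE] := @unitary_of_basis R (fun n => e n *: stdvec n).
- rewrite dotZl dotZr dot_stdvec.
  by have [->|_] := eqVneq i j; rewrite /= ?mulr0n ?mulr0 // mulr1n mulr1 mulrC e1.
- apply: ell2P => k; rewrite -dot_stdvecr -[LHS]mul1r -(e1 k) mulrC mulrA.
  by rewrite [_ * (e k)^*]mulrC -dotZr xe mul0r.
have := dE (f d); rewrite /e -(hP (f d) d erefl).
case: eqP => [-> /eqP|]; last by rewrite scale1r.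
rewrite scaleN1r -subr_eq0 opprK -mulr2n -scaler_nat scaler_eq0 pnatr_eq0 /=.
move=> /eqP e0; have := dot_stdvec R (f d) (f d); rewrite e0 dot0l eqxx.
by move/eqP; rewrite eq_sym oner_eq0.
Qed.

(** Exponents 2^n make the product of two elements of one term lie in the
next.  The union of the E^n is a subgroup containing E, hence everything. *)
Lemma word_power_chain (G : groupType) (E : set G) :
  [set x^-1%g | x in E] = E -> E 1%g -> generates E ->
  exhausting_chain (fun n => word_power E (2 ^ n)).
Proof.
move=> EV E1 Egen.
have powM m n x y : word_power E m x -> word_power E n y -> word_power E (m + n) (x * y)%g.
  move=> [w wE ->] [w' w'E ->].
  exists (fun i => match fintype.split i with inl j => w j | inr j => w' j end).
    by move=> i; case: fintype.split => j.
  rewrite big_split_ord /=; congr (_ * _)%g; apply: eq_bigr => i _.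
    by rewrite (unsplitK (inl i : 'I_m + 'I_n)).
  by rewrite (unsplitK (inr i : 'I_m + 'I_n)).
have pow1 n : word_power E n 1%g.
  by exists (fun _ => 1%g) => //; rewrite big1.
have powS m n : (m <= n)%N -> word_power E m `<=` word_power E n.
  by move=> /subnKC <- x xE; rewrite -[x]mulg1; apply: powM.
have powV n x : word_power E n x -> word_power E n x^-1%g.
  elim: n x => [|n IH] _ [w wE ->].
    by rewrite big_ord0 invg1; exact: pow1.
  rewrite big_ord_recl invgM.
  apply: (powS (n + 1)%N); first by rewrite addn1.
  apply: powM.
    by apply: IH; exists (fun i => w (lift ord0 i)).
  exists (fun _ => (w ord0)^-1%g); last by rewrite big_ord_recl big_ord0 mulg1.
  by move=> _; rewrite -EV; exists (w ord0).
split=> [n|g|n x y xn yn|n x]; last exact: powV.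
- by apply: powS; rewrite leq_exp2l.
- have : smallest (@is_subgroup G) E g by rewrite Egen.
  move=> /(_ [set g | exists n, word_power E n g]) []; last first.
    by move=> n gn; exists n; apply: powS gn; rewrite ltnW // ltn_expl.
  split; last first.
    move=> x xE; exists 1%N; exists (fun _ => x) => //.
    by rewrite big_ord_recl big_ord0 mulg1.
  split=> [|x y [m xm] [n yn]|x [n xn]].
  + by exists 0%N; exact: pow1.
  + by exists (m + n)%N; exact: powM.
  + by exists n; exact: powV.
- by rewrite expnS mul2n -addnn; exact: powM.
Qed.

Theorem theorem1 (R : realType) :
  cayley_bounded (unitary R) /\ uncountable_cofinality (unitary R).
Proof.
split=> [E EV E1 Egen|].
  have [n Wn] := chain_bounded_unitary (word_power_chain EV E1 Egen).
  by exists (2 ^ n)%N.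
split=> [|[H [Hsub Hproper Hincr Hall]]]; first exact: uncountable_unitary.
have [|n Hn] := @chain_bounded_unitary R H; last exact: Hproper Hn.
split=> [//|g|n x y xn yn|n x xn].
- by have : [set: unitary R] g by []; rewrite -Hall => -[n _ gn]; exists n.
- by apply: Hincr; have [_ hM _] := Hsub n; exact: hM.
- by have [_ _ hV] := Hsub n; exact: hV.
Qed.
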